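(* Let $(M,g)$ be a semi-Riemannian manifold of dimension $n\ge3$ satisfying $P\cdot\mathcal P=L\,Q(g,\mathcal P)$ for some $L\in C^\infty(M)$. Then: (i) $(n-1)E=Ln\kappa\,g-(Ln^2-\kappa)\,S-S^2$. (ii) $n^2S^2-2n\kappa S+\kappa^2g=0$ and thus $\kappa^{(2)}=\frac{\kappa^2}{n}$. (iii) $\frac{n}{n-1}(R\cdot\mathcal S)=\frac{1}{n-1}Q(S,\mathcal S)-\frac{nL}{n-1}Q(g,\mathcal S)$ holds if $$R(Y,X_1,X_2,\mathcal SX)+R(Y,X_2,X_1,\mathcal SX)-R(X,X_1,X_2,\mathcal SY)-R(X,X_2,X_1,\mathcal SY)=0$$ for all vector fields $X_1,X_2,X,Y$. (iv) $S\wedge S=g\wedge S^2$.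
   Context: $(M,g)$ is a connected smooth semi-Riemannian manifold of dimension $n\ge 3$; $R$ is the $(0,4)$ Riemann curvature tensor, with the sign convention that the Ricci tensor $S(X_2,X_3)$ is the $g$-trace of $R(X_1,X_2,X_3,X_4)$ over $X_1,X_4$; $\kappa$ is the scalar curvature; $\mathcal S$ is the Ricci operator, $g(\mathcal SX,Y)=S(X,Y)$, $S^2(X,Y)=g(\mathcal S^2X,Y)$, $\kappa^{(2)}=\mathrm{trace}(\mathcal S^2)$. $E(X,Y)$ is the $(0,2)$-tensor obtained by contracting $R(X_1,X,Y,\mathcal SX_2)$ over $X_1,X_2$. Projective curvature tensor: $P(X_1,X_2,X_3,X_4)=R(X_1,X_2,X_3,X_4)-\frac{1}{n-1}\left[S(X_2,X_3)g(X_1,X_4)-S(X_1,X_3)g(X_2,X_4)\right]$; $\mathcal P$ is its $(1,3)$-version, $g(\mathcal P(X,Y)X_1,X_2)=P(X,Y,X_1,X_2)$. An endomorphism $\mathscr L$ of vector fields acts on a $(1,k-1)$-tensor $\mathcal H$ by $(\mathscr L\mathcal H)(X_1,\dots,X_{k-1})=\mathscr L(\mathcal H(X_1,\dots,X_{k-1}))-\sum_i\mathcal H(X_1,\dots,\mathscr LX_i,\dots,X_{k-1})$. For a $(0,4)$-tensor $D$ with associated $(1,3)$-tensor $\mathcal D$ ($g(\mathcal D(X,Y)X_1,X_2)=D(X,Y,X_1,X_2)$), $D\cdot\mathcal H$ is obtained with $\mathscr L=\mathcal D(X,Y)$ ($X,Y$ placed as last arguments); for a symmetric $(0,2)$-tensor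 $A$, $Q(A,\mathcal H)$ is obtained with $\mathscr L=X\wedge_AY$, $(X\wedge_AY)Z=A(Y,Z)X-A(X,Z)Y$. Kulkarni–Nomizu product: $(A\wedge F)(X_1,X_2,X_3,X_4)=A(X_1,X_4)F(X_2,X_3)+A(X_2,X_3)F(X_1,X_4)-A(X_1,X_3)F(X_2,X_4)-A(X_2,X_4)F(X_1,X_3)$. *)

(* Defs.v *)
(* A semi-Riemannian manifold is given by a smooth atlas and
   the Gram matrices of the metric in the charts; the curvature tensor is that of
   the Levi-Civita connection.  Given a chart [c] around a point [p], the tangent
   space at [p] is identified with ['rV[R]_n] through the coordinate frame of
   [c], and a tensor field is given by its value on such row vectors. *)
From HB Require Import structures.
From mathcomp Require Import all_boot all_order all_algebra.
From mathcomp Require Import all_classical all_reals all_analysis.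
Set Implicit Arguments.
Unset Strict Implicit.
Unset Printing Implicit Defensive.
Import Order.TTheory GRing.Theory Num.Theory.
Import numFieldNormedType.Exports.
Local Open Scope classical_set_scope.
Local Open Scope ring_scope.

Definition basis_vec (R : realType) (n : nat) (i : 'I_n) : 'rV[R]_n :=
  delta_mx 0 i.
Arguments basis_vec : clear implicits.

Section Smooth.
Context (R : realType) (n : nat) (W : normedModType R).

Definition partial (i : 'I_n) (f : 'rV[R]_n -> W) (x : 'rV[R]_n) : W :=
  'D_(basis_vec R n i) f x.

Definition iter_partial (s : seq 'I_n) (f : 'rV[R]_n -> W) : 'rV[R]_n -> W :=
  foldr partial f s.

(* [f] is C^infinity on the open set [U]. *)
Definition smooth_on (U : set 'rV[R]_n) (f : 'rV[R]_n -> W) : Prop :=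
  forall (s : seq 'I_n) (x : 'rV[R]_n), U x ->
    {for x, continuous (iter_partial s f)} /\
    (forall i : 'I_n, derivable (iter_partial s f) x (basis_vec R n i)).

End Smooth.

Record smoothManifold (R : realType) (n : nat) := SmoothManifold {
  carrier :> topologicalType;
  manifold_hausdorff : hausdorff_space carrier;
  manifold_second_countable : @second_countable carrier;
  manifold_connected : connected [set: carrier];
  chart : Type;
  dom : chart -> set carrier;
  phi : chart -> carrier -> 'rV[R]_n;
  (* inverse of [phi c]; only its values on [img c] matter *)
  psi : chart -> 'rV[R]_n -> carrier;
  img := fun c => phi c @` dom c;
  dom_open : forall c, open (dom c);
  img_open : forall c, open (img c);
  phi_continuous : forall c, {within dom c, continuous (phi c)};
  psi_continuous : forall c, {within img c, continuous (psi c)};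
  phiK : forall c p, dom c p -> psi c (phi c p) = p;
  charts_cover : forall p, exists c, dom c p;
  transition_smooth : forall c d,
    smooth_on (phi c @` (dom c `&` dom d)) (phi d \o psi c)
}.

Definition smooth_fun (R : realType) (n : nat) (M : smoothManifold R n)
  (f : M -> R) : Prop :=
  forall c : chart M, smooth_on (img c) (f \o psi c : 'rV[R]_n -> R^o).

Record semiRiemannian (R : realType) (n : nat) := SemiRiemannian {
  manifold :> smoothManifold R n;
  (* [metric c p] is the Gram matrix of the metric at [p] in the frame of [c] *)
  metric : chart manifold -> manifold -> 'M[R]_n;
  metric_sym : forall c p, dom c p -> (metric c p)^T = metric c p;
  metric_nondeg : forall c p, dom c p -> metric c p \in unitmx;
  metric_smooth : forall c (i j : 'I_n),
    smooth_on (img c) (fun x => metric c (psi c x) i j : R^o);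
  metric_transform : forall c d p, dom c p -> dom d p ->
    let J := jacobian (phi d \o psi c) (phi c p) in
    metric c p = J *m metric d p *m J^T
}.

Section Curvature.
Context (R : realType) (n : nat) (g : 'rV[R]_n -> 'M[R]_n).
Implicit Types (x : 'rV[R]_n) (a b c d e : 'I_n).

Definition dmetric x a b c : R := partial a (fun y => g y b c : R^o) x.

(* [christoffel d a b x] is Gamma^d_{ab}, from the Koszul formula *)
Definition christoffel d a b x : R :=
  2^-1 * \sum_(e < n) invmx (g x) d e *
    (dmetric x a b e + dmetric x b a e - dmetric x e a b).

Definition dchristoffel a d b c x : R :=
  partial a (christoffel d b c : 'rV[R]_n -> R^o) x.

(* the coefficient of d_d in
   nabla_{d_a} nabla_{d_b} d_c - nabla_{d_b} nabla_{d_a} d_c *)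
Definition curv_coef x a b c d : R :=
  dchristoffel a d b c x - dchristoffel b d a c x +
  \sum_(e < n) (christoffel e b c x * christoffel d a e x -
                christoffel e a c x * christoffel d b e x).

Definition curv_op x (X Y Z : 'rV[R]_n) : 'rV[R]_n :=
  \row_d \sum_(a < n) \sum_(b < n) \sum_(c < n)
    X 0 a * Y 0 b * Z 0 c * curv_coef x a b c d.

End Curvature.

Section TensorAlgebra.
Context (R : realType) (n : nat).
Local Notation V := 'rV[R]_n.
Variable G : 'M[R]_n.

Definition gform (X Y : V) : R := (X *m G *m Y^T) 0 0.

(* the contraction g^{ab} T_{ab} *)
Definition contract (T : V -> V -> R) : R :=
  \sum_(a < n) \sum_(b < n)
    invmx G a b * T (basis_vec R n a) (basis_vec R n b).

(* the vector representing a linear form: gform (sharp alpha) Y = alpha Y *)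
Definition sharp (alpha : V -> R) : V :=
  (\row_(b < n) alpha (basis_vec R n b)) *m invmx G.

Definition op_of_form (D : V -> V -> V -> V -> R) (X Y Z : V) : V :=
  sharp (D X Y Z).

(* A (1,k)-tensor is a function of a family of k vectors. *)
Definition endo_act (k : nat) (f : V -> V) (H : ('I_k -> V) -> V)
    (Z : 'I_k -> V) : V :=
  f (H Z) - \sum_(i < k) H (fun j => if j == i then f (Z i) else Z j).

Definition tensor_dot (k : nat) (D : V -> V -> V -> V -> R)
    (H : ('I_k -> V) -> V) (Z : 'I_k -> V) (X Y : V) : V :=
  endo_act (op_of_form D X Y) H Z.

(* [tensor_dot G D H Z X Y] is (D . H)(Z; X, Y) and [tachibana A H Z X Y] is
   Q(A, H)(Z; X, Y), the pair X, Y being placed last. *)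
Definition wedge_endo (A : V -> V -> R) (X Y Z : V) : V :=
  A Y Z *: X - A X Z *: Y.

Definition tachibana (k : nat) (A : V -> V -> R)
    (H : ('I_k -> V) -> V) (Z : 'I_k -> V) (X Y : V) : V :=
  endo_act (wedge_endo A X Y) H Z.

Definition kulkarni_nomizu (A F : V -> V -> R) (X1 X2 X3 X4 : V) : R :=
  A X1 X4 * F X2 X3 + A X2 X3 * F X1 X4
  - A X1 X3 * F X2 X4 - A X2 X4 * F X1 X3.

End TensorAlgebra.

Section SemiRiemannianTensors.
Context (R : realType) (n : nat) (M : semiRiemannian R n).
Local Notation V := 'rV[R]_n.
Variables (c : chart M) (p : M).
Local Notation G := (metric c p).

Definition gT : V -> V -> R := gform G.

(* [contract G (fun X1 X4 => riemann X1 X2 X3 X4)] is positive on round spheres *)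
Definition riemann (X1 X2 X3 X4 : V) : R :=
  gform G (curv_op (fun x => metric c (psi c x)) (phi c p) X1 X2 X3) X4.

Definition ricci (X2 X3 : V) : R :=
  contract G (fun X1 X4 => riemann X1 X2 X3 X4).

Definition scalar_curv : R := contract G ricci.

Definition ricci_op (X : V) : V := sharp G (ricci X).

Definition ricci2 (X Y : V) : R := gT (ricci_op (ricci_op X)) Y.

(* trace of the square of the Ricci operator *)
Definition scalar_curv2 : R := \tr (lin1_mx (ricci_op \o ricci_op)).

Definition E_tensor (X Y : V) : R :=
  contract G (fun X1 X2 => riemann X1 X Y (ricci_op X2)).

Definition projective (X1 X2 X3 X4 : V) : R :=
  riemann X1 X2 X3 X4
  - (n%:R - 1)^-1 * (ricci X2 X3 * gT X1 X4 - ricci X1 X3 * gT X2 X4).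

Definition projective13 (Z : 'I_3 -> V) : V :=
  op_of_form G projective (Z 0) (Z 1) (Z 2).

Definition ricci11 (Z : 'I_1 -> V) : V := ricci_op (Z 0).

End SemiRiemannianTensors.

(* Main.v *)
(* At a point, let R be the curvature tensor, S the Ricci operator, and
   P(X, Y) = R(X, Y) - (X ^_S Y) / (n - 1).  Contracting P . P = L Q(g, P) with g over
   the second and third arguments gives
     n [R(X, Y), S] Z - [X ^_S Y, S] Z + R(Z, X) S Y - R(Z, Y) S X + R(Z, S Y) X
       - R(Z, S X) Y = L n [X ^_g Y, S] Z.
   Paired with W, this identity is symmetric in (Z, W) except for its second term,
   whose antisymmetric part yields (iv); contracting (iv) yields (ii), and
   the trace over X of the identity yields (i).  Under the hypothesis of (iii) the
   four terms without commutators cancel, and one shows that L (S - kappa / n) = 0,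
   which makes the sign of the L-term irrelevant.
   The algebraic symmetries of R come from metric compatibility of the Christoffel
   symbols together with the symmetry of second partial derivatives of g. *)
Require Import Defs.
From HB Require Import structures.
From mathcomp Require Import all_boot all_order all_algebra.
From mathcomp Require Import all_classical all_reals all_analysis.
From mathcomp Require Import perm ring lra.
Import Order.TTheory GRing.Theory Num.Theory.
Import numFieldNormedType.Exports.
Local Open Scope classical_set_scope.
Local Open Scope ring_scope.

Set Implicit Arguments.
Unset Strict Implicit.

Local Notation contract := Defs.contract.

(** * Contractions with a nondegenerate symmetric form *)

Section Contraction.
Context (R : realType) (n : nat).
Local Notation V := 'rV[R]_n.
Variable G : 'M[R]_n.
Hypotheses (Gsym : G^T = G) (Gunit : G \in unitmx).
Local Notation g := (gform G).

Definition linear_form (f : V -> R) : Prop :=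
  forall a u v, f (a *: u + v) = a * f u + f v.

Definition bilinear_form (T : V -> V -> R) : Prop :=
  (forall y, linear_form (T^~ y)) /\ (forall x, linear_form (T x)).

Lemma linear_form0 (f : V -> R) : linear_form f -> f 0 = 0.
Proof. by move=> lf; have := lf (-1) 0 0; rewrite scaler0 addr0 mulN1r addNr. Qed.

Lemma linear_formD (f : V -> R) u v : linear_form f -> f (u + v) = f u + f v.
Proof. by move=> lf; rewrite -[u in LHS]scale1r lf mul1r. Qed.

Lemma linear_formZ (f : V -> R) a u : linear_form f -> f (a *: u) = a * f u.
Proof. by move=> lf; rewrite -[_ *: _]addr0 lf linear_form0 // addr0. Qed.

Lemma linear_formN (f : V -> R) u : linear_form f -> f (- u) = - f u.
Proof. by move=> lf; rewrite -scaleN1r linear_formZ // mulN1r. Qed.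

Lemma linear_form_comb (f : V -> R) u a b d v w : linear_form f ->
  f (u + a *: (b *: v - d *: w)) = f u + a * (b * f v - d * f w).
Proof.
move=> lf; rewrite linear_formD // linear_formZ // linear_formD // linear_formN //.
by rewrite !linear_formZ.
Qed.

Lemma linear_form_sum (f : V -> R) (a : 'I_n -> R) (v : 'I_n -> V) :
  linear_form f -> f (\sum_i a i *: v i) = \sum_i a i * f (v i).
Proof.
move=> lf; have f0 := linear_form0 lf.
by elim/big_rec2: _ => // i y x _ <-; rewrite lf.
Qed.

Lemma gformC X Y : g X Y = g Y X.
Proof.
have tr11 (A : 'M[R]_1) : A 0 0 = A^T 0 0 by rewrite mxE.
by rewrite /gform tr11 !trmx_mul Gsym trmxK mulmxA.
Qed.

Lemma gform_linearl Y : linear_form (g^~ Y).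
Proof. by move=> a u v; rewrite /gform !mulmxDl -!scalemxAl !mxE. Qed.

Lemma gformDl u v Y : g (u + v) Y = g u Y + g v Y.
Proof. exact: linear_formD (gform_linearl Y). Qed.

Lemma gformZl a u Y : g (a *: u) Y = a * g u Y.
Proof. exact: linear_formZ (gform_linearl Y). Qed.

Lemma gformNl u Y : g (- u) Y = - g u Y.
Proof. exact: linear_formN (gform_linearl Y). Qed.

Definition gformlE := (gformDl, gformZl, gformNl).

Lemma gform_linearr X : linear_form (g X).
Proof. by move=> a u v; rewrite !(gformC X) gform_linearl. Qed.

(** The frame dual to the coordinate frame with respect to [g]: pairing with [cobasis a] reads off
    the [a]-th coordinate. *)
Definition cobasis (a : 'I_n) : V := row a (invmx G).

Lemma gform_basisl X a : g (basis_vec R n a) X = (X *m G) 0 a.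
Proof. by rewrite gformC /gform trmx_delta -colE mxE. Qed.

Lemma gform_cobasis X a : g X (cobasis a) = X 0 a.
Proof.
rewrite /gform /cobasis tr_row trmx_inv Gsym colE mulmxA -mulmxA -mulmxA.
by rewrite (mulmxA G) mulmxV // mul1mx -colE mxE.
Qed.

Lemma basis_expand X : X = \sum_a g X (cobasis a) *: basis_vec R n a.
Proof.
rewrite [LHS]row_sum_delta; apply: eq_bigr => a _.
by rewrite gform_cobasis.
Qed.

Lemma cobasis_expand X : X = \sum_a g (basis_vec R n a) X *: cobasis a.
Proof.
rewrite -[LHS](mulmxK Gunit) mulmx_sum_row; apply: eq_bigr => a _.
by rewrite gform_basisl.
Qed.

Lemma gform_inj U U' : (forall W, g U W = g U' W) -> U = U'.
Proof.
by move=> e; rewrite (basis_expand U) (basis_expand U'); apply: eq_bigr => a _; rewrite e.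
Qed.

Lemma sharp_gform U : sharp G (g U) = U.
Proof.
rewrite -[RHS](mulmxK Gunit) /sharp; congr (_ *m _).
by apply/rowP => a; rewrite mxE gformC gform_basisl.
Qed.

(** Linearity enters because [sharp] samples [f] on the coordinate frame only; the rest follows by
    expanding [W] in both dual frames. *)
Lemma gform_sharp f W : linear_form f -> g (sharp G f) W = f W.
Proof.
move=> lf; rewrite {1}(cobasis_expand W) (linear_form_sum _ _ (gform_linearr _)).
rewrite {2}(basis_expand W) linear_form_sum //.
under eq_bigr => a _ do rewrite gform_cobasis gform_basisl [sharp G f 0 a]mxE mulr_sumr.
under [RHS]eq_bigr => b _ do rewrite gform_cobasis.
rewrite exchange_big /=; apply: eq_bigr => b _; rewrite mxE.
rewrite -[W in RHS](mulmxK Gunit) mxE mulr_suml; apply: eq_bigr => a _.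
have iGs : invmx G b a = invmx G a b by rewrite -[in LHS]Gsym -trmx_inv mxE.
by rewrite iGs; ring.
Qed.

(** The inverse Gram matrix is absorbed into the dual frame, so that a contraction becomes a single
    sum to which the expansion lemmas apply. *)
Lemma contractE T : bilinear_form T ->
  contract G T = \sum_a T (basis_vec R n a) (cobasis a).
Proof.
case=> _ Tr; apply: eq_bigr => a _.
rewrite /cobasis [row _ _]row_sum_delta linear_form_sum //.
by apply: eq_bigr => b _; rewrite mxE.
Qed.

Lemma eq_contract T T' : (forall x y, T x y = T' x y) -> contract G T = contract G T'.
Proof. by move=> e; apply: eq_bigr => a _; apply: eq_bigr => b _; rewrite e. Qed.

Lemma contractD T T' :
  contract G (fun x y => T x y + T' x y) = contract G T + contract G T'.
Proof.
rewrite /contract -big_split; apply: eq_bigr => a _ /=; rewrite -big_split.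
by apply: eq_bigr => b _ /=; rewrite mulrDr.
Qed.

Lemma contractZ k T : contract G (fun x y => k * T x y) = k * contract G T.
Proof.
rewrite /contract mulr_sumr; apply: eq_bigr => a _; rewrite mulr_sumr.
by apply: eq_bigr => b _; ring.
Qed.

Lemma contractN T : contract G (fun x y => - T x y) = - contract G T.
Proof.
by rewrite -mulN1r -contractZ; apply: eq_contract => x y; rewrite mulN1r.
Qed.

Lemma contractC T : contract G (fun x y => T y x) = contract G T.
Proof.
rewrite /contract exchange_big; apply: eq_bigr => a _; apply: eq_bigr => b _ /=.
by rewrite -[in LHS]Gsym -trmx_inv mxE.
Qed.

Lemma contract_gl f U : linear_form f ->
  contract G (fun x y => g x U * f y) = f U.
Proof.
move=> lf; rewrite contractE; last first.
  by split=> [y|x] a u v; rewrite ?gform_linearl ?lf; ring.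
by rewrite {2}(cobasis_expand U) linear_form_sum.
Qed.

Lemma contract_gr f U : linear_form f ->
  contract G (fun x y => f x * g y U) = f U.
Proof. by move=> lf; rewrite -contractC -[RHS]contract_gl //; apply: eq_contract => x y; ring. Qed.

Lemma contract_g : contract G g = n%:R.
Proof.
rewrite contractE; last by split; [exact: gform_linearl|exact: gform_linearr].
under eq_bigr => a _ do rewrite gform_cobasis mxE !eqxx.
by rewrite sumr_const card_ord.
Qed.

(** Cyclicity of the trace: [f] is expanded in the frame, the sums are exchanged, and the
    coefficients reassemble into [f'] applied to the dual frame. *)
Lemma contract_adjoint T f f' : bilinear_form T ->
  (forall x y, g (f x) y = g x (f' y)) ->
  contract G (fun x y => T (f x) y) = contract G (fun x y => T x (f' y)).
Proof.
move=> bT adj; have [Tl Tr] := bT.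
(* By nondegeneracy, adjointness forces both maps to be linear. *)
have lf a u v : f (a *: u + v) = a *: f u + f v.
  by apply: gform_inj => W; rewrite gform_linearl !adj gform_linearl.
have lf' a u v : f' (a *: u + v) = a *: f' u + f' v.
  by apply: gform_inj => W; rewrite gform_linearl !(gformC _ W) -!adj gform_linearr.
rewrite !contractE; try by split=> [y|x] a u v; rewrite ?lf ?lf' ?Tl ?Tr.
under eq_bigr => a _ do rewrite [f _]basis_expand (linear_form_sum _ _ (Tl _)).
rewrite exchange_big; apply: eq_bigr => b _ /=.
rewrite [X in T _ X]cobasis_expand linear_form_sum //.
by apply: eq_bigr => a _; rewrite adj.
Qed.

End Contraction.

(** * Algebraic curvature tensors *)

Section AlgebraicCurvature.
Context (R : realType) (n : nat).
Local Notation V := 'rV[R]_n.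
Variable G : 'M[R]_n.
Hypotheses (Gsym : G^T = G) (Gunit : G \in unitmx).
Local Notation g := (gform G).
Variable r : V -> V -> V -> V.
Hypothesis r_linear1 : forall Y Z a u v, r (a *: u + v) Y Z = a *: r u Y Z + r v Y Z.
Hypothesis r_linear2 : forall X Z a u v, r X (a *: u + v) Z = a *: r X u Z + r X v Z.
Hypothesis r_linear3 : forall X Y a u v, r X Y (a *: u + v) = a *: r X Y u + r X Y v.
Hypothesis r_skew12 : forall X Y Z W, g (r X Y Z) W = - g (r Y X Z) W.
Hypothesis r_skew34 : forall X Y Z W, g (r X Y Z) W = - g (r X Y W) Z.
Hypothesis r_bianchi : forall X Y Z W,
  g (r X Y Z) W + g (r Y Z X) W + g (r Z X Y) W = 0.

(** * Ricci tensor, Ricci operator and their symmetries *)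

Definition ric (Y Z : V) : R := contract G (fun X W => g (r X Y Z) W).
Definition ric_op (X : V) : V := sharp G (ric X).
Definition scal : R := contract G ric.
Definition ric2 (X Y : V) : R := g (ric_op (ric_op X)) Y.
Definition scal2 : R := contract G ric2.
Definition E_form (X Y : V) : R :=
  contract G (fun X1 X2 => g (r X1 X Y) (ric_op X2)).
Local Notation S := ric.
Local Notation so := ric_op.
Local Notation kappa := scal.

(** The four Bianchi identities for the cyclic rotations of [X, Y, Z, W] combine, through the two
    skew symmetries, into twice this identity. *)
Lemma r_pair X Y Z W : g (r X Y Z) W = g (r Z W X) Y.
Proof.
have := r_bianchi X Y Z W; have := r_bianchi Y Z W X.
have := r_bianchi Z W X Y; have := r_bianchi W X Y Z.
rewrite (r_skew34 Y Z W) (r_skew34 Z W Y) (r_skew34 W X Y) (r_skew34 X Y W).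
rewrite (r_skew12 X Z W) (r_skew34 Z X W) (r_skew12 Y W X) (r_skew34 W Y X); lra.
Qed.

Lemma ric_sym Y Z : S Y Z = S Z Y.
Proof.
rewrite /ric -contractC //; apply: eq_contract => X W.
by rewrite r_pair r_skew12 r_skew34 opprK.
Qed.

Lemma ric_linearl Z : linear_form (S^~ Z).
Proof.
move=> a u v; rewrite /ric -contractZ -contractD; apply: eq_contract => X W.
by rewrite r_linear2 gform_linearl.
Qed.

Lemma ric_linearr Y : linear_form (S Y).
Proof. by move=> a u v; rewrite !(ric_sym Y) ric_linearl. Qed.

Lemma gform_ric_op X Y : g (so X) Y = S X Y.
Proof. by rewrite gform_sharp //; exact: ric_linearr. Qed.

Lemma ric_gform Y Z : S Y Z = g Z (so Y).
Proof. by rewrite gformC // gform_ric_op. Qed.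

Lemma ric_op_selfadjoint X Y : g (so X) Y = g X (so Y).
Proof. by rewrite gform_ric_op ric_sym ric_gform. Qed.

Lemma ric_op_linear a u v : so (a *: u + v) = a *: so u + so v.
Proof.
apply: (gform_inj Gsym Gunit) => W.
by rewrite gform_linearl !gform_ric_op ric_linearl.
Qed.

Definition linE := (r_linear1, r_linear2, r_linear3, ric_op_linear,
  @gform_linearl R n G, gform_linearr Gsym, ric_linearl, ric_linearr).

Lemma ric_ric_op X Y : S (so X) Y = S X (so Y).
Proof. by rewrite -!gform_ric_op ric_op_selfadjoint. Qed.

Lemma ric_ric_op_sym X Y : S X (so Y) = S Y (so X).
Proof. by rewrite ric_sym ric_ric_op. Qed.

(** Every linear form is [g] paired with its [sharp], so a contraction known after pairing with all
    [W] is known under any linear form. *)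
Lemma contract_vector (f : V -> R) (F : V -> V -> V) (U : V) : linear_form f ->
  (forall W, contract G (fun x y => g (F x y) W) = g U W) ->
  contract G (fun x y => f (F x y)) = f U.
Proof.
move=> lf h; rewrite -[RHS](gform_sharp Gsym Gunit _ lf) gformC // -h.
by apply: eq_contract => x y; rewrite -[LHS](gform_sharp Gsym Gunit _ lf) gformC.
Qed.

(** Infinitesimal isometries act trivially on the metric, hence their derivation kills any
    contraction; moving [Q] across the trace changes its sign. *)
Lemma contract_skew (T : V -> V -> R) (Q : V -> V) : bilinear_form T ->
  (forall x y, g (Q x) y = - g x (Q y)) ->
  contract G (fun x y => T (Q x) y) + contract G (fun x y => T x (Q y)) = 0.
Proof.
move=> bT sQ; have [_ Tr] := bT.
rewrite (@contract_adjoint _ _ _ Gsym Gunit T Q (fun y => - Q y)) //; last first.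
  by move=> x y; rewrite sQ linear_formN //; exact: gform_linearr.
rewrite -contractD /contract big1 // => a _; rewrite big1 // => b _.
by rewrite linear_formN // addNr mulr0.
Qed.

(** * The projective curvature operator and its trace *)

Definition wedge_g (X Y Z : V) : V := g Y Z *: X - g X Z *: Y.

Variable L : R.
Hypothesis hn : n%:R - 1 != 0 :> R.
Local Notation c := (- (n%:R - 1)^-1).

Definition proj_op (X Y Z : V) : V := r X Y Z + c *: (S Y Z *: X - S X Z *: Y).
Local Notation pr := proj_op.
Local Notation w := wedge_g.

Lemma proj_opE X Y Z : pr X Y Z = r X Y Z + c *: (S Y Z *: X - S X Z *: Y).
Proof. by []. Qed.

Lemma gform_proj_op X Y Z W :
  g (pr X Y Z) W = g (r X Y Z) W + c * (S Y Z * g X W - S X Z * g Y W). 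
Proof. by rewrite /proj_op !gformlE. Qed.

Lemma gform_wedge_g X Y Z W : g (w X Y Z) W = g Y Z * g X W - g X Z * g Y W.
Proof. by rewrite /wedge_g !gformlE. Qed.

Lemma proj_op_linear2 X Z W : linear_form (fun Y => g (pr X Y Z) W).
Proof. by move=> a u v; rewrite !gform_proj_op !linE; ring. Qed.
Lemma proj_op_linear3 X Y W : linear_form (fun Z => g (pr X Y Z) W).
Proof. by move=> a u v; rewrite !gform_proj_op !linE; ring. Qed.

(** The curvature part traces to [S X W]. Here [1 - c] equals n / (n - 1), the source of the factor
    n in the contracted identity. *)
Lemma contract_proj_op X W : contract G (fun Z1 Z2 => g (pr X Z1 Z2) W)
  = g ((1 - c) *: so X + (c * kappa) *: X) W.
Proof.
rewrite !gformlE gform_ric_op.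
transitivity (contract G (fun Z1 Z2 => g (r Z1 X W) Z2
   + (c * g X W * S Z1 Z2 + (- c) * (g Z1 W * S X Z2)))).
  apply: eq_contract => Z1 Z2; rewrite gform_proj_op (r_skew12 X Z1) (r_skew34 Z1 X); ring.
rewrite !contractD !contractZ contract_gl //; last exact: ric_linearr.
by rewrite -/(S X W) -/kappa; ring.
Qed.

Local Opaque gform proj_op wedge_g ric ric_op Defs.contract.

(* [ring] and [lra] compare atoms up to conversion, which is prohibitive here. *)
Ltac generalize_atoms := repeat match goal with
  | |- context [gform G ?x ?y] => generalize (gform G x y); intro
  | |- context [ric ?x ?y] => generalize (ric x y); intro
  | |- context [ric2 ?x ?y] => generalize (ric2 x y); intro
  end.

Ltac expand_proj_op := repeat match goal with
  | |- context [gform G (proj_op ?x ?y ?z) ?u] =>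
      generalize (gform_proj_op x y z u); generalize (gform G (proj_op x y z) u);
      let e := fresh in intros ? e; rewrite {}e
  end.

(** * The curvature condition and its contraction *)

Hypothesis hPP : forall X Y Z0 Z1 Z2,
  pr X Y (pr Z0 Z1 Z2)
    - (pr (pr X Y Z0) Z1 Z2 + (pr Z0 (pr X Y Z1) Z2 + pr Z0 Z1 (pr X Y Z2)))
  = L *: (w X Y (pr Z0 Z1 Z2)
    - (pr (w X Y Z0) Z1 Z2 + (pr Z0 (w X Y Z1) Z2 + pr Z0 Z1 (w X Y Z2)))).

(* [g([X ^_g Y, S] Z, W)] *)
Definition wedge_ric_comm X Y Z W := S Y Z * g X W - S X Z * g Y W - g Y Z * S X W + g X Z * S Y W.

(* Contraction of [hPP] over [Z1, Z2]: the trace commutes with skew-adjoint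
   endomorphisms, so of the terms acting on [Z1, Z2] only those coming from the
   non-skew part [X ^_S Y] of the projective curvature operator survive. *)
Lemma proj_dot_contracted X Y Z W :
  n%:R * (g (r X Y (so Z)) W - g (r X Y Z) (so W))
  - (S Y (so Z) * g X W - S X (so Z) * g Y W - S Y Z * S X W + S X Z * S Y W)
  + (g (r Z X (so Y)) W - g (r Z Y (so X)) W + g (r Z (so Y) X) W - g (r Z (so X) Y) W)
  = L * n%:R * wedge_ric_comm X Y Z W.
Proof.
(* The contracted derivation along [A] is split into its action on the value ([f1]), on the free
   argument ([f2]) and on the two traced arguments ([f3]). *)
pose f1 A := contract G (fun Z1 Z2 => g (A (pr Z Z1 Z2)) W).
pose f2 A := contract G (fun Z1 Z2 => g (pr (A Z) Z1 Z2) W).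
pose f3 (A : V -> V) := contract G (fun Z1 Z2 => g (pr Z (A Z1) Z2) W)
   + contract G (fun Z1 Z2 => g (pr Z Z1 (A Z2)) W).
have key : f1 (pr X Y) - (f2 (pr X Y) + f3 (pr X Y)) = L * (f1 (w X Y) - (f2 (w X Y) + f3 (w X Y))).
  pose F A Z1 Z2 := g (A (pr Z Z1 Z2)) W + - (g (pr (A Z) Z1 Z2) W
    + (g (pr Z (A Z1) Z2) W + g (pr Z Z1 (A Z2)) W)).
  have FE A : contract G (F A) = f1 A - (f2 A + f3 A) by rewrite /F contractD contractN !contractD.
  rewrite -!FE -contractZ; apply: eq_contract => Z1 Z2.
  have gE p q s t : g p W + - (g q W + (g s W + g t W)) = g (p - (q + (s + t))) W.
    by rewrite !gformlE.
  by rewrite /F !gE -gformZl hPP.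
have f1E A : linear_form (fun u => g (A u) W) -> f1 A = (1 - c) * g (A (so Z)) W + c * kappa * g (A Z) W.
  move=> lA; rewrite /f1 (@contract_vector (fun u => g (A u) W) _ ((1 - c) *: so Z + (c * kappa) *: Z)) //; last exact: contract_proj_op.
  by rewrite lA; congr (_ + _); exact: linear_formZ lA.
have f2E A : f2 A = (1 - c) * g (A Z) (so W) + c * kappa * g (A Z) W.
  by rewrite /f2 contract_proj_op !gformlE ric_op_selfadjoint.
have bpr : bilinear_form (fun Z1 Z2 => g (pr Z Z1 Z2) W).
  by split=> [y|x]; [exact: proj_op_linear2|exact: proj_op_linear3].
have f3w : f3 (w X Y) = 0.
  rewrite /f3 (contract_skew bpr) // => x y.
  by rewrite [in RHS]gformC // !gform_wedge_g (gformC Gsym Y y) (gformC Gsym X y); ring.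
have f3pr : f3 (pr X Y) = c * (g (pr Z X (so Y)) W - g (pr Z Y (so X)) W
    + g (pr Z (so Y) X) W - g (pr Z (so X) Y) W).
  transitivity (f3 (r X Y) + c * (
      contract G (fun Z1 Z2 => g Z1 (so Y) * g (pr Z X Z2) W)
      - contract G (fun Z1 Z2 => g Z1 (so X) * g (pr Z Y Z2) W)
      + contract G (fun Z1 Z2 => g (pr Z Z1 X) W * g Z2 (so Y))
      - contract G (fun Z1 Z2 => g (pr Z Z1 Y) W * g Z2 (so X)))).
    rewrite /f3 -!contractN -!contractD -contractZ -contractD.
    apply: eq_contract => Z1 Z2; rewrite -!ric_gform (proj_opE X Y Z1) (proj_opE X Y Z2).
    have l2 u a b d v v' : g (pr Z (u + a *: (b *: v - d *: v')) Z2) W = _ :=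
      linear_form_comb u a b d v v' (proj_op_linear2 Z Z2 W).
    have l3 u a b d v v' : g (pr Z Z1 (u + a *: (b *: v - d *: v'))) W = _ :=
      linear_form_comb u a b d v v' (proj_op_linear3 Z Z1 W).
    by rewrite l2 l3; generalize_atoms; ring.
  rewrite /f3 (contract_skew bpr) //; last by move=> x y; rewrite r_skew34 gformC.
  by rewrite !contract_gl ?contract_gr ?add0r //; [exact: proj_op_linear2|exact: proj_op_linear2|exact: proj_op_linear3|exact: proj_op_linear3].
move: key; rewrite f3w f3pr !f1E ?f2E; first last.
- by move=> a u v; rewrite !gform_proj_op !linE; generalize_atoms; ring.
- by move=> a u v; rewrite !gform_wedge_g !linE; generalize_atoms; ring.
(* This clears denominators. The scalar curvature terms of [f1] and [f2] cancel, and the commutator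
   of [X ^_S Y] with the Ricci operator receives - n / (n - 1) from [f1] and [f2] and 1 / (n - 1)
   from [f3], in total -1. *)
move=> /(congr1 ( *%R (n%:R - 1))).
expand_proj_op.
rewrite !gform_wedge_g /wedge_ric_comm !ric_ric_op -!ric_gform.
rewrite !gform_ric_op (ric_sym Z X) (ric_sym Z Y) (ric_sym W X) (ric_sym W Y).
rewrite (ric_ric_op_sym Z X) (ric_ric_op_sym Z Y) (ric_ric_op_sym Y X).
generalize_atoms => h.
by refine (etrans _ (etrans h _)); field.
Qed.

(** * Traces and antisymmetrisation of the contracted identity *)

Lemma ric2E X Y : ric2 X Y = S X (so Y).
Proof. by rewrite /ric2 gform_ric_op ric_ric_op. Qed.

Lemma contract_antisym (T : V -> V -> R) :
  (forall x y, T x y = - T y x) -> contract G T = 0.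
Proof.
move=> sT; have : contract G T = - contract G T.
  by rewrite -contractN -[LHS]contractC //; apply: eq_contract => x y; rewrite sT.
lra.
Qed.

Lemma r_ric_op_bilinear Y Z : bilinear_form (fun X W => g (r X Y Z) W).
Proof. by split=> [W|X] a u v; rewrite !linE. Qed.

Lemma r_bilinear34 X Y : bilinear_form (fun Z W => g (r X Y Z) W).
Proof. by split=> [W|Z] a u v; rewrite !linE. Qed.

(* The trace of a product of a skew-adjoint and a self-adjoint operator is 0. *)
Lemma contract_r_ric_op34 X Y : contract G (fun Z W => g (r X Y (so Z)) W) = 0.
Proof.
have e1 := contract_adjoint Gsym Gunit (r_bilinear34 X Y) ric_op_selfadjoint.
have e2 : contract G (fun Z W => g (r X Y (so Z)) W) = - contract G (fun Z W => g (r X Y Z) (so W)).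
  by rewrite -contractN -[RHS]contractC //; apply: eq_contract => Z W; rewrite r_skew34.
lra.
Qed.

(** Moving the Ricci operator to the other traced slot and applying pair symmetry interchanges the
    two free arguments. *)
Lemma E_form_sym X Y : E_form X Y = E_form Y X.
Proof.
rewrite /E_form -[LHS](contract_adjoint Gsym Gunit (r_ric_op_bilinear X Y) ric_op_selfadjoint).
rewrite -[LHS]contractC //; apply: eq_contract => W Z.
by rewrite r_pair r_skew12 r_skew34 opprK.
Qed.

(* Contraction of [proj_dot_contracted] over [X, W]. *)
Lemma E_formE X Y :
  (n%:R - 1) * E_form X Y
  = L * n%:R * kappa * g X Y - (L * n%:R ^+ 2 - kappa) * S X Y - ric2 X Y.
Proof.
rename X into Y, Y into Z.
have : contract G (fun X W =>
    n%:R * g (r X Y (so Z)) W + - n%:R * g (r X Y Z) (so W)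
    + - S Y (so Z) * g X W + S X (so Z) * g W Y + S Y Z * S X W
    + -1 * (S X Z * g W (so Y)) + -1 * g (r X Z (so Y)) W
    + -1 * g (r Z Y (so X)) W + g (r Z (so Y) X) W + g (r (so X) Z Y) W)
  = contract G (fun X W => L * n%:R *
    (S Y Z * g X W + -1 * (S X Z * g W Y) + - g Y Z * S X W + g X Z * S W Y)).
  apply: eq_contract => X W; have := proj_dot_contracted X Y Z W; rewrite /wedge_ric_comm.
  rewrite (gformC Gsym W Y) -(ric_gform Y W) (r_skew12 X Z) (r_skew12 (so X) Z).
  by rewrite (ric_sym W Y) => h; refine (etrans _ (etrans h _)); generalize_atoms; ring.
rewrite !contractD !contractZ !contractD !contractZ.
rewrite !contract_gr ?contract_gl ?contract_g //; try by move=> a u v; rewrite linE.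
have -> : contract G (fun X W => g (r X Y (so Z)) W) = S Y (so Z) by [].
have -> : contract G (fun X W => g (r X Z (so Y)) W) = S Z (so Y) by [].
have -> : contract G (fun X W => g (r X Y Z) (so W)) = E_form Y Z by [].
(* This second copy of E, with coefficient 1 against - n for the first, produces the factor n -
   1. *)
have -> : contract G (fun X W => g (r (so X) Z Y) W) = E_form Y Z.
  by rewrite E_form_sym; exact: contract_adjoint (r_ric_op_bilinear Z Y) ric_op_selfadjoint.
have -> : contract G (fun X W => S X W) = kappa by [].
(* Two terms are traces of a skew-adjoint operator, alone or composed with the self-adjoint Ricci
   operator; both vanish. *)
rewrite (contract_antisym (r_skew34 Z (so Y))).
rewrite contract_r_ric_op34.
rewrite ric2E (ric_ric_op_sym Z Y) (ric_ric_op Y Z) (ric_sym Z Y); generalize_atoms => *.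
lra.
Qed.

(* The part of [proj_dot_contracted] that is antisymmetric in [Z, W]. *)
Lemma ric_kn X1 X2 X3 X4 :
  kulkarni_nomizu S S X1 X2 X3 X4 = kulkarni_nomizu g ric2 X1 X2 X3 X4.
Proof.
have := proj_dot_contracted X1 X2 X3 X4; have := proj_dot_contracted X1 X2 X4 X3.
rewrite /kulkarni_nomizu /wedge_ric_comm !ric2E.
rewrite (r_skew34 X1 X2 (so X4)) (r_skew34 X1 X2 X4 (so X3)).
(* Pair symmetry gives the remaining curvature terms the same form in both instances, so that they
   drop out of the difference. *)
rewrite (r_pair X4 X1 (so X2) X3) (r_skew12 (so X2)) (r_skew34 X3 (so X2) X4) opprK.
rewrite (r_pair X4 X2 (so X1) X3) (r_skew12 (so X1)) (r_skew34 X3 (so X1) X4) opprK.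
rewrite (r_pair X4 (so X2) X1 X3) (r_skew12 X1 X3 X4) (r_skew34 X3 X1 X4) opprK.
rewrite (r_pair X4 (so X1) X2 X3) (r_skew12 X2 X3 X4) (r_skew34 X3 X2 X4) opprK.
rewrite (ric_ric_op_sym X1 X4); generalize_atoms => *; lra.
Qed.

Lemma ric2_linearl Y : linear_form (ric2^~ Y).
Proof. by move=> a u v; rewrite /ric2 !linE. Qed.

Local Opaque ric2 E_form scal scal2.

(** Contraction of [ric_kn] over its first and last arguments; both sides contain - 2 S^2, which
    cancels. *)
Lemma ric2_contracted X Y : 2 * kappa * S X Y = n%:R * ric2 X Y + scal2 * g X Y.
Proof.
have : contract G (fun U W => 2 * S X Y * S U W + -2 * (S U Y * g W (so X)))
  = contract G (fun U W => ric2 X Y * g U W + g X Y * ric2 U W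
     + -1 * (ric2 U Y * g W X) + -1 * (g U Y * ric2 X W)).
  apply: eq_contract => U W; have := ric_kn U X Y W.
  rewrite /kulkarni_nomizu -ric_gform (gformC Gsym W X).
  by generalize_atoms => *; lra.
have c1 : contract G (fun U W => S U Y * g W (so X)) = S (so X) Y.
  exact/(contract_gr Gsym Gunit (so X))/ric_linearl.
have c2 : contract G (fun U W => ric2 U Y * g W X) = ric2 X Y.
  exact/(contract_gr Gsym Gunit X)/ric2_linearl.
have c3 : contract G (fun U W => g U Y * ric2 X W) = ric2 X Y.
  apply: contract_gl => // a u v.
  by rewrite !ric2E !linE.
have c4 : contract G ric2 = scal2 by [].
have c5 : contract G S = kappa by [].
rewrite 4!contractD !contractZ c1 c2 c3 c4 c5 contract_g // ric_ric_op -ric2E.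
by generalize_atoms => h; lra.
Qed.

Hypothesis hn0 : n%:R != 0 :> R.

(** The trace of [ric2_contracted] reads 2 kappa^2 = 2 n [scal2]. *)
Lemma scal2E : scal2 = kappa ^+ 2 / n%:R.
Proof.
have : contract G (fun X Y => 2 * kappa * S X Y)
  = contract G (fun X Y => n%:R * ric2 X Y + scal2 * g X Y).
  by apply: eq_contract => X Y; exact: ric2_contracted.
rewrite !contractD !contractZ contract_g //.
have -> : contract G ric2 = scal2 by []; have -> : contract G S = kappa by [] => h.
by apply: (mulIf hn0); rewrite divfK //; lra.
Qed.

Lemma ric2_quadratic X Y :
  n%:R ^+ 2 * ric2 X Y - 2 * n%:R * kappa * S X Y + kappa ^+ 2 * g X Y = 0.
Proof.
have -> : 2 * n%:R * kappa * S X Y = n%:R * (2 * kappa * S X Y) by ring.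
by rewrite ric2_contracted scal2E; field.
Qed.

(** Reconciles the metric contraction with the matrix trace: pairing with [cobasis a] extracts the
    [a]-th diagonal entry. *)
Lemma scal2_trace : scal2 = \tr (lin1_mx (ric_op \o ric_op)).
Proof.
rewrite [LHS]contractE; last by split=> x a u v; rewrite ?ric2E !linE.
apply: eq_bigr => a _; rewrite mxE.
exact: (gform_cobasis Gsym Gunit).
Qed.

(** * Consequences of the cyclic condition *)

Hypothesis cyclic_cond : forall X1 X2 X Y,
  g (r Y X1 X2) (so X) + g (r Y X2 X1) (so X)
  - g (r X X1 X2) (so Y) - g (r X X2 X1) (so Y) = 0.

(** Trace of the cyclic condition over [X] and [X2]: the first and fourth terms vanish by skewness,
    the second gives - E and the third S^2. *)
Lemma E_form_eq_ric2 Y Z : E_form Y Z = ric2 Y Z.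
Proof.
have : contract G (fun X W => g (r Y Z W) (so X) + -1 * g (r W Y Z) (so X)
    + g (r X Z (so Y)) W + -1 * g (r X W Z) (so Y)) = contract G (fun X W => 0 * g X W).
  apply: eq_contract => X W; have := cyclic_cond Z W X Y.
  by rewrite (r_skew12 Y W Z) (r_skew34 X Z W) mul0r => <-; ring.
rewrite !contractD !contractZ mul0r.
have -> : contract G (fun X W => g (r X Z (so Y)) W) = S Z (so Y) by [].
rewrite (contract_antisym (T := fun X W => g (r X W Z) (so Y))); last by move=> X W; rewrite r_skew12.
have -> : contract G (fun X W => g (r W Y Z) (so X)) = E_form Y Z by rewrite -contractC.
have -> : contract G (fun X W => g (r Y Z W) (so X)) = 0.
  rewrite -contractC // -(contract_r_ric_op34 Y Z); apply/esym.
  exact: contract_adjoint (r_bilinear34 Y Z) ric_op_selfadjoint.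
rewrite ric2E (ric_ric_op_sym Z Y); lra.
Qed.

(** Scaled by n to avoid a division. *)
Definition traceless_ric X Y := n%:R * S X Y - kappa * g X Y.

(** Multiplying [ric_kn] by n^2 and eliminating n^2 S^2 with [ric2_quadratic] completes a square: T
    ^ T = 0, so all 2 by 2 minors of T vanish. *)
Lemma traceless_ric_rank_le1 X1 X2 X3 X4 : traceless_ric X1 X4 * traceless_ric X2 X3 = traceless_ric X1 X3 * traceless_ric X2 X4.
Proof.
have := congr1 ( *%R (n%:R ^+ 2)) (ric_kn X1 X2 X3 X4); rewrite /kulkarni_nomizu /traceless_ric.
have := congr1 ( *%R (g X1 X4)) (ric2_quadratic X2 X3).
have := congr1 ( *%R (g X2 X3)) (ric2_quadratic X1 X4).
have := congr1 ( *%R (g X1 X3)) (ric2_quadratic X2 X4).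
have := congr1 ( *%R (g X2 X4)) (ric2_quadratic X1 X3).
rewrite !mulr0; generalize_atoms => h1 h2 h3 h4 h5; lra.
Qed.

(** With E = S^2, n times [E_formE] and [ric2_quadratic] both determine n^2 S^2; their difference
    factors. *)
Lemma scal_traceless_ric0 X Y : (kappa + L * n%:R ^+ 2) * traceless_ric X Y = 0.
Proof.
have := congr1 ( *%R n%:R) (E_formE X Y); rewrite E_form_eq_ric2 /traceless_ric.
have := ric2_quadratic X Y; generalize_atoms => h1 h2; lra.
Qed.

(* If the traceless part T of S is nonzero, then kappa = - L n^2, and then all terms
   of [proj_dot_contracted] other than [R(X, Y), S] cancel, so [R(X, Y), S] = 0.  As T has
   rank at most 1, T (R(X, Y) Z) = 0; tracing gives kappa T = 0, so kappa = L = 0. *)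
Lemma L_traceless_ric0 A B : L * traceless_ric A B = 0.
Proof.
have [->|TAB] := eqVneq (traceless_ric A B) 0; first by rewrite mulr0.
have kL : kappa = - (L * n%:R ^+ 2).
  by apply/eqP; rewrite -addr_eq0; have /eqP := scal_traceless_ric0 A B; rewrite mulf_eq0 (negPf TAB) orbF.
have D0 X Y Z W : g (r X Y (so Z)) W = g (r X Y Z) (so W).
  apply/eqP; rewrite -subr_eq0; apply/eqP/(mulfI hn0); rewrite mulr0.
  have := proj_dot_contracted X Y Z W; have := cyclic_cond Z W X Y.
  rewrite (r_skew12 Z X) (r_skew34 X Z (so Y)) opprK (r_skew12 Z Y) (r_skew34 Y Z (so X)) opprK.
  rewrite (r_pair Z (so Y)) (r_pair Z (so X)).
  (* The minors and the quadratic relation turn the commutator of [X ^_S Y] into kappa / n times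
     that of [X ^_g Y], which [kL] balances against the L-term. *)
  have := traceless_ric_rank_le1 X Y Z W.
  have := congr1 ( *%R (g X W)) (ric2_quadratic Y Z).
  have := congr1 ( *%R (g Y W)) (ric2_quadratic X Z).
  rewrite !mulr0 /traceless_ric /wedge_ric_comm -!ric2E kL; generalize_atoms => h1 h2 h3.
  move=> /(congr1 ( *%R (n%:R ^+ 2))) h4 /(congr1 ( *%R (n%:R ^+ 2))) h5.
  by apply: (mulfI (expf_neq0 2 hn0)); lra.
have TQ X Y Z W : traceless_ric (r X Y Z) W = - traceless_ric (r X Y W) Z.
  rewrite /traceless_ric !(ric_sym (r X Y _)) (ric_gform W) (ric_gform Z) -D0 (r_skew34 X Y W).
  by rewrite (r_skew34 X Y W); ring.
have T0 X Y Z W : traceless_ric (r X Y Z) W = 0.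
  apply: (mulIf TAB); rewrite mul0r.
  (* Chaining the three minor relations with the skewness [TQ] leads from the product of T (R(X, Y)
     Z, W) and T (A, B) back to its negative. *)
  have := traceless_ric_rank_le1 (r X Y Z) A B W.
  have := traceless_ric_rank_le1 (r X Y B) A W Z.
  have := traceless_ric_rank_le1 (r X Y W) A Z B.
  rewrite (TQ X Y Z B) (TQ X Y B W) (TQ X Y W Z) => h1 h2 h3; lra.
(* Tracing [T0] gives n E = kappa S; since E = S^2, the quadratic relation turns this into kappa T =
   0. *)
have : contract G (fun X W => n%:R * g (r X A B) (so W) + - kappa * g (r X A B) W)
    = contract G (fun X W => 0 * g X W).
  apply: eq_contract => X W; rewrite mul0r -(T0 X A B W) /traceless_ric (ric_sym (r X A B)) (ric_gform W); ring.
have c1 : contract G (fun X W => g (r X A B) (so W)) = E_form A B by [].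
have c2 : contract G (fun X W => g (r X A B) W) = S A B by [].
rewrite contractD !contractZ c1 c2 mul0r E_form_eq_ric2 => h.
have : kappa * traceless_ric A B = 0.
  by have := ric2_quadratic A B; rewrite /traceless_ric; move: h => /(congr1 ( *%R n%:R)); generalize_atoms => h1 h2; lra.
move/eqP; rewrite mulf_eq0 (negPf TAB) orbF kL oppr_eq0 mulf_eq0 expf_eq0 (negPf hn0).
by rewrite andbF orbF => /eqP ->; rewrite mul0r.
Qed.

(* The sign of the last term is immaterial, since that term vanishes. *)
Lemma ric_dot X Y Z W :
  n%:R * (g (r X Y (so Z)) W - g (r X Y Z) (so W))
  = (S Y (so Z) * g X W - S X (so Z) * g Y W - S Y Z * S X W + S X Z * S Y W)
    - n%:R * L * wedge_ric_comm X Y Z W.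
Proof.
have LC : L * n%:R * wedge_ric_comm X Y Z W = 0.
  have := congr1 ( *%R (g X W)) (L_traceless_ric0 Y Z); have := congr1 ( *%R (g Y W)) (L_traceless_ric0 X Z).
  have := congr1 ( *%R (g Y Z)) (L_traceless_ric0 X W); have := congr1 ( *%R (g X Z)) (L_traceless_ric0 Y W).
  by rewrite !mulr0 /traceless_ric /wedge_ric_comm; generalize_atoms => h1 h2 h3 h4; lra.
have := proj_dot_contracted X Y Z W; rewrite LC (mulrC n%:R L) LC.
have := cyclic_cond Z W X Y.
rewrite (r_skew12 Z X) (r_skew34 X Z (so Y)) opprK (r_skew12 Z Y) (r_skew34 Y Z (so X)) opprK.
rewrite (r_pair Z (so Y)) (r_pair Z (so X)).
by generalize_atoms => h1 h2; lra.
Qed.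

End AlgebraicCurvature.

(** * Symmetry of second derivatives *)

Section MixedPartials.
Context (R : realType) (V : normedModType R).
Implicit Types (f : V -> R^o) (x u v : V).

Lemma is_derive_line f x u (t : R) : derivable f (t *: u + x) u ->
  is_derive t 1 (fun s : R => f (s *: u + x)) ('D_u f (t *: u + x)).
Proof.
have e : (fun h : R => h^-1 *: (((fun s : R => f (s *: u + x)) \o shift t) (h *: 1)
    - f (t *: u + x))) = (fun h : R => h^-1 *: ((f \o shift (t *: u + x)) (h *: u)
    - f (t *: u + x))).
  by apply/funext => h /=; rewrite [h *: 1]mulr1 scalerDl addrA.
by move=> df; split; rewrite /derivable /derive e.
Qed.

Lemma is_derive_translate f x a u : derivable f (a + x) u ->
  is_derive x u (fun y => f (a + y)) ('D_u f (a + x)).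
Proof.
have e : (fun h : R => h^-1 *: (((fun y => f (a + y)) \o shift x) (h *: u)
    - f (a + x))) = (fun h : R => h^-1 *: ((f \o shift (a + x)) (h *: u)
    - f (a + x))).
  by apply/funext => h /=; rewrite addrCA.
by move=> df; split; rewrite /derivable /derive e.
Qed.

Lemma mvt_line f x u (h : R) : 0 < h ->
  (forall t, 0 <= t <= h -> derivable f (t *: u + x) u) ->
  exists2 t, 0 <= t <= h & f (h *: u + x) - f x = h * 'D_u f (t *: u + x).
Proof.
move=> h0 df; pose F s : R := f (s *: u + x).
have dF t : t \in `[0, h] -> is_derive t 1 F ('D_u f (t *: u + x)).
  by rewrite in_itv => /df; exact: is_derive_line.
have dF' t : t \in `]0, h[ -> is_derive t 1 F ('D_u f (t *: u + x)).
  by move=> th; apply: dF; apply: subset_itv_oo_cc.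
have cF : {within `[0, h], continuous F}.
  by apply: derivable_within_continuous => t /dF[].
have [t th e] := MVT h0 dF' cF.
exists t; first by have := subset_itv_oo_cc th; rewrite /= in_itv.
by move: e; rewrite /F scale0r add0r subr0 mulrC.
Qed.

(** The mean value theorem is applied twice, along [u] to the increment of [f] in direction
    [h *: v], then along [v] to the derivative of [f] in direction [u]. The bound on [h] keeps the
    whole parallelogram in the ball. *)
Lemma second_difference f x u v (e h : R) : 0 < h -> h * (`|u| + `|v|) < e ->
  (forall y, ball x e y -> derivable f y u /\ derivable ('D_u f) y v) ->
  exists2 y, ball x e y &
    f (h *: u + (h *: v + x)) - f (h *: v + x) - (f (h *: u + x) - f x)
    = h ^+ 2 * 'D_v ('D_u f) y.
Proof.
move=> h0 he df.
have inball s t : 0 <= s <= h -> 0 <= t <= h -> ball x e (t *: v + (s *: u + x)).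
  move=> /andP[s0 sh] /andP[t0 th]; rewrite -ball_normE /= addrA opprD addrCA subrr addr0 normrN.
  apply: le_lt_trans he; rewrite mulrDr addrC (le_trans (ler_normD _ _)) // !normrZ !ger0_norm //.
  by rewrite lerD // ler_wpM2r.
pose F : V -> R^o := (fun y => f (h *: v + y)) - f.
have lh : 0 <= h <= h by rewrite (ltW h0) lexx.
have l0 : 0 <= (0 : R) <= h by rewrite (ltW h0) lexx.
have dFE t : 0 <= t <= h -> is_derive (t *: u + x) u F ('D_u f (h *: v + (t *: u + x)) - 'D_u f (t *: u + x)).
  move=> th; apply: is_deriveB.
    exact: is_derive_translate (df _ (inball t h th lh)).1.
  by apply: DeriveDef => //; have [] := df _ (inball t 0 th l0); rewrite scale0r add0r.
have [t th e1] := @mvt_line F x u h h0 (fun t th => @ex_derive _ _ _ _ _ _ _ (dFE t th)).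
have [s sh e2] := @mvt_line ('D_u f) (t *: u + x) v h h0 (fun s sh => (df _ (inball t s th sh)).2).
exists (s *: v + (t *: u + x)); first exact: inball.
have -> : f (h *: u + (h *: v + x)) - f (h *: v + x) - (f (h *: u + x) - f x) = F (h *: u + x) - F x.
  by rewrite /F !fctE (addrCA (h *: v)); ring.
by rewrite e1 (@derive_val _ _ _ _ _ _ _ (dFE t th)) e2 expr2 mulrA.
Qed.

(** Schwarz's theorem: one second difference equals h^2 times either mixed derivative at nearby
    points, and continuity carries the equality to [x] up to any [eps]. *)
Lemma mixed_partials f x u v :
  (\forall y \near x, [/\ derivable f y u, derivable f y v,
     derivable ('D_u f) y v & derivable ('D_v f) y u]) ->
  {for x, continuous ('D_v ('D_u f))} -> {for x, continuous ('D_u ('D_v f))} ->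
  'D_v ('D_u f) x = 'D_u ('D_v f) x.
Proof.
move=> df c1 c2; apply/eqP; rewrite -subr_eq0 -normr_le0; apply/ler_addgt0Pl => eps eps0.
have e20 : 0 < eps / 2 by rewrite divr_gt0.
have n1 : \forall y \near x, `|'D_v ('D_u f) x - 'D_v ('D_u f) y| < eps / 2.
  exact: (cvgrPdist_lt _ _).1 c1 _ e20.
have n2 : \forall y \near x, `|'D_u ('D_v f) x - 'D_u ('D_v f) y| < eps / 2.
  exact: (cvgrPdist_lt _ _).1 c2 _ e20.
have /nbhs_ballP[e /= e0 he] : nbhs x (fun y => [/\ derivable f y u, derivable f y v,
     derivable ('D_u f) y v & derivable ('D_v f) y u] /\
     (`|'D_v ('D_u f) x - 'D_v ('D_u f) y| < eps / 2 /\ `|'D_u ('D_v f) x - 'D_u ('D_v f) y| < eps / 2)).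
  exact: filterI df (filterI n1 n2).
(* The summand 1 keeps the denominator positive even when both vectors vanish. *)
pose h : R := e / 2 / (`|u| + `|v| + 1).
have uv0 : 0 < `|u| + `|v| + 1 by rewrite ltr_wpDl // addr_ge0.
have h0 : 0 < h by rewrite !divr_gt0.
have hlt : h * (`|u| + `|v|) < e.
  apply: (@lt_le_trans _ _ (h * (`|u| + `|v| + 1))); first by rewrite ltr_pM2l // ltrDl.
  by rewrite /h divfK ?gt_eqF // ler_pdivrMr // mulr_natr mulr2n lerDl ltW.
have hlt' : h * (`|v| + `|u|) < e by rewrite [`|v| + _]addrC.
have [y yb e1] := second_difference h0 hlt (fun y yb => let: conj (And4 a b c d) _ := he y yb in conj a c).
have [z zb e2] := second_difference h0 hlt' (fun y yb => let: conj (And4 a b c d) _ := he y yb in conj b d).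
rewrite (addrCA (h *: v)) in e2.
have yz : 'D_v ('D_u f) y = 'D_u ('D_v f) z.
  apply: (mulfI (expf_neq0 2 (lt0r_neq0 h0))).
  have ac (a b c d : R^o) : a - b - (c - d) = a - c - (b - d).
    by rewrite !opprB addrACA [RHS]addrACA [- b + _]addrC [- c + _]addrC.
  exact: etrans (esym e1) (etrans (ac _ _ _ _) e2).
have [_ [d1 _]] := he y yb; have [_ [_ d2]] := he z zb.
move: d1 d2; rewrite yz addr0; move: ('D_v _ x) ('D_u _ x) ('D_u _ z) => p q s d1 d2.
have -> : p - q = (p - s) - (q - s) by rewrite opprB addrA subrK.
apply: (le_trans (ler_normB _ _)); rewrite [leRHS](splitr eps).
exact/ltW/ltrD.
Qed.
End MixedPartials.

(** * Levi-Civita curvature in coordinates *)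

Section MatrixDerivability.
Context (R : realType) (V : normedModType R).
Implicit Types (x v : V).

Lemma derivable_bigsum (I : finType) (f : I -> V -> R^o) x v :
  (forall i, derivable (f i) x v) -> derivable (fun y => \sum_i f i y) x v.
Proof.
move=> df; rewrite [X in derivable X](_ : _ = \sum_i f i); last by apply/funext => y; rewrite fct_sumE.
apply: (@big_ind _ (fun g => derivable g x v)) => [|g h|i _].
- exact: derivable_cst.
- exact: derivableD.
- exact: df.
Qed.

Lemma derivable_bigprod (I : finType) (f : I -> V -> R) x v :
  (forall i, derivable (f i : V -> R^o) x v) -> derivable ((fun y => \prod_i f i y) : V -> R^o) x v.
Proof.
move=> df; rewrite [X in derivable X](_ : _ = \prod_i f i); last by apply/funext => y; rewrite fct_prodE.
apply: (@big_ind _ (fun g : V -> R^o => derivable g x v)) => [|g h|i _].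
- exact: derivable_cst.
- exact: derivableM.
- exact: df.
Qed.

Lemma derivable_det m (A : V -> 'M[R]_m) x v :
  (forall i j, derivable ((fun y => A y i j) : V -> R^o) x v) ->
  derivable ((fun y => \det (A y)) : V -> R^o) x v.
Proof.
move=> dA; apply: derivable_bigsum => s.
rewrite [X in derivable X](_ : _ =
  (cst ((-1) ^+ s) : V -> R^o) * (fun y => \prod_i A y i (s i))) //.
apply: derivableM; first exact: derivable_cst.
by apply: derivable_bigprod => i; exact: dA.
Qed.

(** Cofactor formula. Invertibility is required near [x] because [invmx] is given by the adjugate
    only on invertible matrices. *)
Lemma derivable_invmx m (A : V -> 'M[R]_m) x v i j :
  (\forall y \near x, A y \in unitmx) ->
  (forall i j, derivable ((fun y => A y i j) : V -> R^o) x v) ->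
  derivable ((fun y => invmx (A y) i j) : V -> R^o) x v.
Proof.
move=> uA dA.
apply: (@near_eq_derivable _ _ _ ((fun y => (\det (A y))^-1) * (fun y => \adj (A y) i j) : V -> R^o)).
  by near=> y; rewrite /invmx (near uA y) // mxE.
apply: derivableM.
  apply: derivableV; last exact: derivable_det.
  by have := nbhs_singleton uA; rewrite unitmxE unitfE.
rewrite [X in derivable X](_ : _ = (cst ((-1) ^+ (j + i))) * (fun y => \det (row' j (col' i (A y))))); last first.
  by apply/funext => y; rewrite mxE.
apply: derivableM; first exact: derivable_cst.
apply: derivable_det => k l.
by rewrite [X in derivable X](_ : _ = (fun y => A y (lift j k) (lift i l))) //; apply/funext => y; rewrite !mxE.
Unshelve. all: by end_near. Qed.

End MatrixDerivability.

(** * Christoffel symbols and the symmetries of the curvature tensor *)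

Section LeviCivita.
Context (R : realType) (n : nat) (gm : 'rV[R]_n -> 'M[R]_n) (U : set 'rV[R]_n).
Hypotheses (oU : open U) (symU : forall y, U y -> (gm y)^T = gm y)
  (unitU : forall y, U y -> gm y \in unitmx)
  (smoothU : forall i j, smooth_on U (fun y => gm y i j : R^o)).
Implicit Types (x y : 'rV[R]_n) (a b c d e f i j : 'I_n).
Local Notation D := (dmetric gm).
Local Notation Gam := (christoffel gm).
Local Notation entry i j := (fun y => gm y i j : R^o).

Lemma near_open_domain x : U x -> \forall y \near x, U y.
Proof. by move=> Ux; apply: open_nbhs_nbhs; split. Qed.

Lemma derivable_entry x a i j : U x -> derivable (entry i j) x (basis_vec R n a).
Proof. by move=> /(smoothU i j [::])[_ /(_ a)]. Qed.

Lemma derivable_dmetric x a b i j : U x ->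
  derivable (fun y => D y b i j : R^o) x (basis_vec R n a).
Proof. by move=> /(smoothU i j [:: b])[_ /(_ a)]. Qed.

Lemma dmetric_sym x a i j : U x -> D x a i j = D x a j i.
Proof.
move=> Ux; apply: near_eq_derive; near=> y.
have Uy : U y by near: y; exact: near_open_domain.
by rewrite -[in LHS](symU Uy) mxE.
Unshelve. all: by end_near. Qed.

Lemma dmetric_mixed x a b i j : U x ->
  partial a (fun y => D y b i j : R^o) x = partial b (fun y => D y a i j : R^o) x.
Proof.
move=> Ux; apply: mixed_partials.
- near=> y; have Uy : U y by near: y; exact: near_open_domain.
  by split; [exact: derivable_entry|exact: derivable_entry|exact: derivable_dmetric|exact: derivable_dmetric].
- exact: (smoothU i j [:: a; b] Ux).1.
- exact: (smoothU i j [:: b; a] Ux).1.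
Unshelve. all: by end_near. Qed.

(* Christoffel symbols of the first kind, Gamma_{f, bc}. *)
Definition lower_christoffel f b c y : R :=
  2^-1 * (D y b c f + D y c b f - D y f b c).
Local Notation Lam := lower_christoffel.

Ltac generalize_symbols := repeat match goal with
  | |- context [dchristoffel ?g ?a ?b ?c ?d ?z] => generalize (dchristoffel g a b c d z); intro
  | |- context [christoffel ?g ?a ?b ?c ?z] => generalize (christoffel g a b c z); intro
  | |- context [lower_christoffel ?a ?b ?c ?z] => generalize (lower_christoffel a b c z); intro
  | |- context [dmetric ?g ?a ?b ?c ?z] => generalize (dmetric g a b c z); intro
  | |- context [fun_of_matrix ?A ?a ?b] => generalize (fun_of_matrix A a b); intro
  end.

Lemma christoffelE d b c y : Gam d b c y = \sum_e invmx (gm y) d e * Lam e b c y.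
Proof.
by rewrite /christoffel mulr_sumr; apply: eq_bigr => e _; rewrite /Lam mulrCA.
Qed.

Lemma christoffel_lower f b c y : U y -> \sum_d Gam d b c y * gm y d f = Lam f b c y.
Proof.
move=> Uy; under eq_bigr => d _ do rewrite christoffelE mulr_suml.
rewrite exchange_big /=.
transitivity (\sum_e (gm y *m invmx (gm y)) f e * Lam e b c y).
  apply: eq_bigr => e _; rewrite mxE mulr_suml; apply: eq_bigr => d _.
  have -> : gm y d f = gm y f d by rewrite -[in LHS](symU Uy) mxE.
  by rewrite mulrC mulrA.
rewrite mulmxV ?unitU // (bigD1 f) //= mxE eqxx mul1r big1 ?addr0 // => e ne.
by rewrite mxE eq_sym (negPf ne) mul0r.
Qed.

Lemma christoffel_sym d b c y : U y -> Gam d b c y = Gam d c b y.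
Proof.
move=> Uy; rewrite !christoffelE; apply: eq_bigr => e _.
by rewrite /Lam (dmetric_sym e b c Uy) (addrC (D y b c e)).
Qed.

(** The coordinate form of nabla g = 0. *)
Lemma metric_compat a d f y : U y -> D y a d f = Lam f a d y + Lam d a f y.
Proof.
move=> Uy; rewrite /Lam (dmetric_sym a f d Uy) -mulrDr.
by move: (D y a d f) (D y d a f) (D y f a d) => p q s; lra.
Qed.

Lemma derivable_lower_christoffel f b c x a : U x -> derivable (Lam f b c : _ -> R^o) x (basis_vec R n a).
Proof.
move=> Ux; apply: (@derivableM _ _ (cst 2^-1) (fun y => D y b c f + D y c b f - D y f b c)); first exact: derivable_cst.
by apply: derivableB; [apply: derivableD|]; exact: derivable_dmetric.
Qed.

Lemma derivable_christoffel d b c x a : U x ->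
  derivable (Gam d b c : _ -> R^o) x (basis_vec R n a).
Proof.
move=> Ux; rewrite [X in derivable X](_ : _ = (fun y => \sum_e invmx (gm y) d e * Lam e b c y)); last first.
  by apply/funext => y; exact: christoffelE.
apply: derivable_bigsum => e.
apply: (@derivableM _ _ (fun y => invmx (gm y) d e) (Lam e b c)); last exact: derivable_lower_christoffel.
apply: derivable_invmx; last by move=> *; exact: derivable_entry.
by apply: filterS (near_open_domain Ux) => y /unitU.
Qed.

(** Leibniz rule for [christoffel_lower]; it trades derivatives of Gamma^d_{bc} for those of the
    lowered symbols, with no derivative of the inverse metric. *)
Lemma partial_lower_christoffel a f b c x : U x ->
  partial a (Lam f b c : _ -> R^o) x =
  \sum_d (Gam d b c x * D x a d f + dchristoffel gm a d b c x * gm x d f).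
Proof.
move=> Ux; rewrite /partial.
transitivity ('D_(basis_vec R n a) (\sum_d (Gam d b c * (fun y => gm y d f)) : _ -> R^o) x).
  apply: near_eq_derive; near=> y; have Uy : U y by near: y; exact: near_open_domain.
  by rewrite -christoffel_lower // fct_sumE.
rewrite derive_sum => [|d]; last first.
  by apply: derivableM; [exact: derivable_christoffel|exact: derivable_entry].
apply: eq_bigr => d _.
rewrite deriveM; [|exact: derivable_christoffel|exact: derivable_entry].
by rewrite /dchristoffel /partial; congr (_ + _); rewrite mulrC.
Unshelve. all: by end_near. Qed.

(** The components R_{abcf} of the (0,4) curvature tensor. *)
Definition lower_curv x a b c f : R := \sum_d curv_coef gm x a b c d * gm x d f.

(** Metric compatibility replaces the derivatives of g, and half of the quadratic terms cancel. In
    the remaining form the skewness in [c, f] becomes visible. *)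
Lemma lower_curvE x a b c f : U x -> lower_curv x a b c f =
  partial a (Lam f b c : _ -> R^o) x - partial b (Lam f a c : _ -> R^o) x
  - \sum_d Gam d b c x * Lam d a f x + \sum_d Gam d a c x * Lam d b f x.
Proof.
move=> Ux; rewrite !partial_lower_christoffel // /lower_curv /curv_coef.
under eq_bigr => d _ do rewrite mulrDl mulr_suml.
rewrite big_split /= exchange_big /=.
have -> : \sum_e \sum_d (Gam e b c x * Gam d a e x - Gam e a c x * Gam d b e x) * gm x d f
  = \sum_d (Gam d b c x * Lam f a d x - Gam d a c x * Lam f b d x).
  apply: eq_bigr => e _; rewrite -!christoffel_lower // !mulr_sumr -sumrB.
  by apply: eq_bigr => d _; generalize_symbols; ring.
rewrite -!sumrB -!big_split; apply: eq_bigr => d _ /=.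
by rewrite (metric_compat a d f Ux) (metric_compat b d f Ux); generalize_symbols; ring.
Qed.

(** Both sides are the inverse metric applied to Gamma_{., bc} and Gamma_{., af}. *)
Lemma christoffel_pairing_sym x a b c f : 
  U x -> \sum_d Gam d b c x * Lam d a f x = \sum_d Gam d a f x * Lam d b c x.
Proof.
move=> Ux; under eq_bigr => d _ do rewrite christoffelE mulr_suml.
rewrite exchange_big; apply: eq_bigr => e _ /=; rewrite christoffelE mulr_suml.
apply: eq_bigr => d _.
have -> : invmx (gm x) d e = invmx (gm x) e d by rewrite -[in LHS](symU Ux) -trmx_inv mxE.
by generalize_symbols; ring.
Qed.

Lemma partial_metric_compat a b c f x : U x ->
  partial a (Lam f b c : _ -> R^o) x + partial a (Lam c b f : _ -> R^o) x
  = partial a (fun y => D y b c f : R^o) x.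
Proof.
move=> Ux; rewrite /partial -deriveD; [|exact: derivable_lower_christoffel|exact: derivable_lower_christoffel].
apply: near_eq_derive; near=> y; have Uy : U y by near: y; exact: near_open_domain.
by rewrite (metric_compat b c f Uy).
Unshelve. all: by end_near. Qed.

(** In R_{abcf} + R_{abfc} the derivative terms add up to the commutator of second partials of
    g_{cf}, which is zero, and the quadratic terms cancel in pairs. *)
Lemma lower_curv_skew34 x a b c f : U x -> lower_curv x a b c f = - lower_curv x a b f c.
Proof.
move=> Ux; rewrite !lower_curvE //.
have aux (p p' q q' P P' s1 s2 s3 s4 : R) : p + q = P -> p' + q' = P' -> P = P' ->
  s1 = s4 -> s3 = s2 -> p - p' - s1 + s2 = - (q - q' - s3 + s4) by lra.
exact: aux (partial_metric_compat a b c f Ux) (partial_metric_compat b a c f Ux)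
  (dmetric_mixed a b c f Ux) (christoffel_pairing_sym a b c f Ux) (christoffel_pairing_sym a b f c Ux).
Qed.

Lemma dchristoffel_sym x a b c d : U x -> dchristoffel gm a d b c x = dchristoffel gm a d c b x.
Proof.
move=> Ux; apply: near_eq_derive; near=> y; have Uy : U y by near: y; exact: near_open_domain.
exact: christoffel_sym.
Unshelve. all: by end_near. Qed.

(** Vanishing torsion, that is, symmetry of Gamma in its lower indices, makes derivative and
    quadratic terms cancel separately. *)
Lemma curv_coef_bianchi x a b c d : U x ->
  curv_coef gm x a b c d + curv_coef gm x b c a d + curv_coef gm x c a b d = 0.
Proof.
move=> Ux; rewrite /curv_coef.
rewrite (dchristoffel_sym b a c d Ux) (dchristoffel_sym c b a d Ux) (dchristoffel_sym a b c d Ux).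
have aux (p q s t u v : R) : t + u + v = 0 -> p - q + t + (q - s + u) + (s - p + v) = 0 by lra.
apply: aux; rewrite -!big_split big1 // => e _ /=.
rewrite (christoffel_sym e b a Ux) (christoffel_sym e c a Ux) (christoffel_sym e c b Ux).
by generalize_symbols; ring.
Qed.

Lemma curv_coef_skew x a b c d : curv_coef gm x a b c d = - curv_coef gm x b a c d.
Proof.
rewrite /curv_coef opprD opprB -sumrN; congr (_ + _).
by apply: eq_bigr => e _; rewrite opprB.
Qed.

Local Notation r := (curv_op gm).

Lemma gform_curv_op x X Y Z W : gform (gm x) (r x X Y Z) W =
  \sum_a \sum_b \sum_c \sum_f X 0 a * Y 0 b * Z 0 c * W 0 f * lower_curv x a b c f.
Proof.
have aux (p q s t : R) : p * q * s * t = p * t * (q * s) by ring.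
rewrite /gform mxE.
transitivity (\sum_f \sum_d \sum_a \sum_b \sum_c
   X 0 a * Y 0 b * Z 0 c * W 0 f * (curv_coef gm x a b c d * gm x d f)).
  apply: eq_bigr => f _; rewrite !mxE mulr_suml; apply: eq_bigr => d _; rewrite !mxE !mulr_suml.
  apply: eq_bigr => a _; rewrite !mulr_suml; apply: eq_bigr => b _; rewrite !mulr_suml.
  by apply: eq_bigr => c _; exact: aux.
do ![under eq_bigr => f _ do rewrite exchange_big /=;
  rewrite exchange_big /=; apply: eq_bigr => ? _].
by apply: eq_bigr => f _; rewrite /lower_curv mulr_sumr.
Qed.

Lemma curv_op_skew34 x X Y Z W : U x ->
  gform (gm x) (r x X Y Z) W = - gform (gm x) (r x X Y W) Z.
Proof.
move=> Ux; rewrite !gform_curv_op -sumrN; apply: eq_bigr => a _; rewrite -sumrN.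
apply: eq_bigr => b _; rewrite -sumrN exchange_big; apply: eq_bigr => f _ /=; rewrite -sumrN.
by apply: eq_bigr => c _; rewrite lower_curv_skew34 // mulrN (mulrAC _ (Z 0 c)).
Qed.

Lemma curv_opE x X Y Z d : r x X Y Z 0 d =
  \sum_a \sum_b \sum_c X 0 a * Y 0 b * Z 0 c * curv_coef gm x a b c d.
Proof. by rewrite mxE. Qed.

Lemma curv_op_bianchi x X Y Z : U x -> r x X Y Z + r x Y Z X + r x Z X Y = 0.
Proof.
move=> Ux; apply/rowP => d; rewrite [RHS]mxE mxE [X in X + _]mxE !curv_opE.
have r1 (p q s : R) : q * s * p = p * q * s by ring.
have r2 (p q s : R) : s * p * q = p * q * s by ring.
have -> : \sum_b \sum_c \sum_a Y 0 b * Z 0 c * X 0 a * curv_coef gm x b c a d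
  = \sum_a \sum_b \sum_c X 0 a * Y 0 b * Z 0 c * curv_coef gm x b c a d.
  under eq_bigr => b _ do rewrite exchange_big /=.
  rewrite exchange_big; do 3![apply: eq_bigr => ? _ /=].
  by congr (_ * _); exact: r1.
have -> : \sum_c \sum_a \sum_b Z 0 c * X 0 a * Y 0 b * curv_coef gm x c a b d
  = \sum_a \sum_b \sum_c X 0 a * Y 0 b * Z 0 c * curv_coef gm x c a b d.
  rewrite exchange_big; apply: eq_bigr => a _ /=; rewrite exchange_big.
  do 2![apply: eq_bigr => ? _ /=].
  by congr (_ * _); exact: r2.
rewrite -!big_split big1 // => a _ /=; rewrite -!big_split big1 // => b _ /=.
rewrite -!big_split big1 // => c _ /=.
by rewrite -!mulrDr curv_coef_bianchi // mulr0.
Qed.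

Lemma curv_op_skew12 x X Y Z : r x X Y Z = - r x Y X Z.
Proof.
apply/rowP => d; rewrite [RHS]mxE !curv_opE exchange_big -sumrN; apply: eq_bigr => b _ /=.
rewrite -sumrN; apply: eq_bigr => a _; rewrite -sumrN; apply: eq_bigr => c _.
by rewrite curv_coef_skew mulrN (mulrC (X 0 a)).
Qed.

Lemma curv_op_linear3 x X Y (k : R) (u v : 'rV[R]_n) :
  r x X Y (k *: u + v) = k *: r x X Y u + r x X Y v.
Proof.
have aux (p q s t w : R) : p * (w * q + s) * t = w * (p * q * t) + p * s * t by ring.
apply/rowP => d; rewrite [RHS]mxE [X in _ = X + _]mxE !curv_opE.
do 3![rewrite mulr_sumr -big_split; apply: eq_bigr => ? _ /=].
by rewrite !mxE; exact: aux.
Qed.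

Lemma curv_op_linear2 x X Z (k : R) (u v : 'rV[R]_n) :
  r x X (k *: u + v) Z = k *: r x X u Z + r x X v Z.
Proof.
have aux (p q s t w z : R) : p * (w * q + s) * z * t = w * (p * q * z * t) + p * s * z * t by ring.
apply/rowP => d; rewrite [RHS]mxE [X in _ = X + _]mxE !curv_opE.
do 3![rewrite mulr_sumr -big_split; apply: eq_bigr => ? _ /=].
by rewrite !mxE; exact: aux.
Qed.

Lemma curv_op_linear1 x Y Z (k : R) (u v : 'rV[R]_n) :
  r x (k *: u + v) Y Z = k *: r x u Y Z + r x v Y Z.
Proof.
by rewrite curv_op_skew12 curv_op_linear2 !(curv_op_skew12 _ Y) !scalerN opprD !opprK.
Qed.

End LeviCivita.

(** * The curvature condition at a point *)

Section AtPoint.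
Context (R : realType) (n : nat) (M : semiRiemannian R n) (c : chart M) (p : M).
Hypotheses (hn : (3 <= n)%N) (hp : dom c p).
Local Notation V := 'rV[R]_n.
Local Notation gm := (fun x => metric c (psi c x)).
Local Notation G := (metric c p).
Local Notation r := (curv_op gm (phi c p)).

Lemma img_phi : img c (phi c p). Proof. by exists p. Qed.

Lemma gm_phi : gm (phi c p) = G. Proof. by rewrite /= phiK. Qed.

Lemma gm_sym x : img c x -> (gm x)^T = gm x.
Proof. by case=> q hq <-; rewrite /= phiK // Defs.metric_sym. Qed.

Lemma gm_unit x : img c x -> gm x \in unitmx.
Proof. by case=> q hq <-; rewrite /= phiK // metric_nondeg. Qed.

Let Gsym : G^T = G. Proof. exact: Defs.metric_sym. Qed.
Let Gunit : G \in unitmx. Proof. exact: metric_nondeg. Qed.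
Let r1 := curv_op_linear1 gm (phi c p).
Let r2 := curv_op_linear2 gm (phi c p).
Let r3 := curv_op_linear3 gm (phi c p).

Let s12 X Y Z W : gform G (r X Y Z) W = - gform G (r Y X Z) W.
Proof. by rewrite curv_op_skew12 gformNl. Qed.

Let s34 X Y Z W : gform G (r X Y Z) W = - gform G (r X Y W) Z.
Proof.
rewrite -gm_phi; apply: (curv_op_skew34 (U := img c)).
- exact: img_open.
- exact: gm_sym.
- exact: gm_unit.
- exact: metric_smooth.
- exact: img_phi.
Qed.

Let bianchi X Y Z W :
  gform G (r X Y Z) W + gform G (r Y Z X) W + gform G (r Z X Y) W = 0.
Proof.
rewrite -!gformDl (curv_op_bianchi (U := img c)) ?/gform ?mul0mx ?mxE //.
- exact: img_open.
- exact: gm_sym.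
- exact: img_phi.
Qed.

Let n0 : n%:R != 0 :> R.
Proof. by rewrite pnatr_eq0 -lt0n (leq_trans _ hn). Qed.

Let n10 : n%:R - 1 != 0 :> R.
Proof. by rewrite subr_eq0 -[1]/(1%:R) eqr_nat gtn_eqF // (leq_trans _ hn). Qed.

Lemma ricciE X Y : ricci c p X Y = ric G r X Y. Proof. by []. Qed.
Lemma ricci_opE X : ricci_op c p X = ric_op G r X. Proof. by []. Qed.
Lemma scalar_curvE : scalar_curv c p = scal G r. Proof. by []. Qed.
Lemma ricci2E X Y : ricci2 c p X Y = ric2 G r X Y. Proof. by []. Qed.

Lemma op_of_projective X Y Z : op_of_form G (projective c p) X Y Z = proj_op G r X Y Z.
Proof.
rewrite -[RHS](sharp_gform Gsym Gunit); congr (sharp G _); apply/funext => W.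
by rewrite gform_proj_op mulNr.
Qed.

Lemma op_of_riemann X Y Z : op_of_form G (riemann c p) X Y Z = r X Y Z.
Proof. by rewrite -[RHS](sharp_gform Gsym Gunit). Qed.

Variable l : R.
Hypothesis hPP : forall (Z : 'I_3 -> V) (X Y : V),
  tensor_dot G (projective c p) (projective13 c p) Z X Y
  = l *: tachibana (gT c p) (projective13 c p) Z X Y.

Let pr := proj_op G r.

(** Families of three vectors are given as entries of an explicit list, so that replacing one
    argument computes. *)
Lemma endo_act_projective f Z0 Z1 Z2 :
  endo_act f (projective13 c p) (fun i : 'I_3 => [:: Z0; Z1; Z2]`_i)
  = f (pr Z0 Z1 Z2) - (pr (f Z0) Z1 Z2 + (pr Z0 (f Z1) Z2 + pr Z0 Z1 (f Z2))).
Proof.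
by rewrite /endo_act /projective13 !big_ord_recl big_ord0 addr0 !op_of_projective.
Qed.

Let hpr X Y Z0 Z1 Z2 :
  pr X Y (pr Z0 Z1 Z2)
    - (pr (pr X Y Z0) Z1 Z2 + (pr Z0 (pr X Y Z1) Z2 + pr Z0 Z1 (pr X Y Z2)))
  = l *: (wedge_g G X Y (pr Z0 Z1 Z2) - (pr (wedge_g G X Y Z0) Z1 Z2
      + (pr Z0 (wedge_g G X Y Z1) Z2 + pr Z0 Z1 (wedge_g G X Y Z2)))).
Proof.
have := hPP (fun i : 'I_3 => [:: Z0; Z1; Z2]`_i) X Y.
by rewrite /tensor_dot /tachibana !endo_act_projective !op_of_projective.
Qed.

Lemma E_tensorE X Y : (n%:R - 1) * E_tensor c p X Y
  = l * n%:R * scalar_curv c p * gT c p X Y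
    - (l * n%:R ^+ 2 - scalar_curv c p) * ricci c p X Y - ricci2 c p X Y.
Proof.
have -> : E_tensor c p X Y = E_form G r X Y by [].
rewrite scalar_curvE ricciE ricci2E.
have h := E_formE Gsym Gunit r1 r2 r3 s12 s34 bianchi n10 hpr X Y.
exact: h.
Qed.

Lemma ricci2_quadratic X Y : n%:R ^+ 2 * ricci2 c p X Y
  - 2 * n%:R * scalar_curv c p * ricci c p X Y + scalar_curv c p ^+ 2 * gT c p X Y = 0.
Proof.
rewrite scalar_curvE ricciE ricci2E.
have h := ric2_quadratic Gsym Gunit r2 r3 s12 s34 bianchi n10 hpr n0 X Y.
exact: h.
Qed.

Lemma scalar_curv2E : scalar_curv2 c p = scalar_curv c p ^+ 2 / n%:R.
Proof.
rewrite scalar_curvE -(scal2E Gsym Gunit r2 r3 s12 s34 bianchi n10 hpr n0).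
by rewrite (scal2_trace Gsym Gunit r2 s12 s34 bianchi).
Qed.

Lemma ricci_kulkarni_nomizu X1 X2 X3 X4 :
  kulkarni_nomizu (ricci c p) (ricci c p) X1 X2 X3 X4
  = kulkarni_nomizu (gT c p) (ricci2 c p) X1 X2 X3 X4.
Proof.
have := ric_kn Gsym Gunit r2 r3 s12 s34 bianchi n10 hpr X1 X2 X3 X4.
by rewrite /kulkarni_nomizu !ricciE !ricci2E.
Qed.

Lemma endo_act_ricci11 f (Z : 'I_1 -> V) :
  endo_act f (ricci11 c p) Z = f (ricci_op c p (Z 0)) - ricci_op c p (f (Z 0)).
Proof. by rewrite /endo_act /ricci11 big_ord1. Qed.

Lemma riemann_dot_ricci (Z : 'I_1 -> V) X Y :
  (forall X1 X2 X Y : V,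
    riemann c p Y X1 X2 (ricci_op c p X) + riemann c p Y X2 X1 (ricci_op c p X)
    - riemann c p X X1 X2 (ricci_op c p Y) - riemann c p X X2 X1 (ricci_op c p Y) = 0) ->
  (n%:R / (n%:R - 1)) *: tensor_dot G (riemann c p) (ricci11 c p) Z X Y
  = (n%:R - 1)^-1 *: tachibana (ricci c p) (ricci11 c p) Z X Y
    - (n%:R * l / (n%:R - 1)) *: tachibana (gT c p) (ricci11 c p) Z X Y.
Proof.
move=> hcyc; apply: (gform_inj Gsym Gunit) => W.
rewrite /tensor_dot /tachibana !endo_act_ricci11 !op_of_riemann.
have sa X' Y' : gform G (ricci_op c p X') Y' = gform G X' (ricci_op c p Y').
  exact (ric_op_selfadjoint Gsym Gunit r2 s12 s34 bianchi X' Y').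
have gE X' Y' : gform G (ricci_op c p X') Y' = ricci c p X' Y'.
  exact (gform_ric_op Gsym Gunit r2 s12 s34 bianchi X' Y').
have gr X' Y' : gform G X' (ricci_op c p Y') = ricci c p X' Y' by rewrite -sa gE.
have := ric_dot Gsym Gunit r1 r2 r3 s12 s34 bianchi n10 hpr n0 hcyc X Y (Z 0) W.
rewrite /wedge_ric_comm -!ricciE -!ricci_opE.
rewrite !gformlE !sa /gT /wedge_endo !gformlE !gr => h.
(* This brings n next to the commutator of R(X, Y) with the Ricci operator, where [ric_dot] applies;
   the common factor 1 / (n - 1) remains. *)
rewrite mulrAC h.
repeat match goal with
  | |- context [gform ?A ?x ?y] => generalize (gform A x y); intro
  | |- context [ricci c p ?x ?y] => generalize (ricci c p x y); intro
  end.
ring.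
Qed.

End AtPoint.

Unset Implicit Arguments.
Theorem theorem4p15 (R : realType) (n : nat) (hn : (3 <= n)%N)
  (M : semiRiemannian R n) (L : M -> R) (hL : smooth_fun L)
  (hPP : forall (c : chart M) (p : M), dom c p ->
     forall (Z : 'I_3 -> 'rV[R]_n) (X Y : 'rV[R]_n),
       tensor_dot (metric c p) (projective c p) (projective13 c p) Z X Y
       = L p *: tachibana (gT c p) (projective13 c p) Z X Y) :
  (* (i) *)
  (forall (c : chart M) (p : M), dom c p -> forall X Y : 'rV[R]_n,
     (n%:R - 1) * E_tensor c p X Y
     = L p * n%:R * scalar_curv c p * gT c p X Y
       - (L p * n%:R ^+ 2 - scalar_curv c p) * ricci c p X Y
       - ricci2 c p X Y)
  /\
  (* (ii) *)
  ((forall (c : chart M) (p : M), dom c p -> forall X Y : 'rV[R]_n,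
      n%:R ^+ 2 * ricci2 c p X Y
      - 2 * n%:R * scalar_curv c p * ricci c p X Y
      + scalar_curv c p ^+ 2 * gT c p X Y = 0)
   /\
   (forall (c : chart M) (p : M), dom c p ->
      scalar_curv2 c p = scalar_curv c p ^+ 2 / n%:R))
  /\
  (* (iii) *)
  ((forall (c : chart M) (p : M), dom c p -> forall X1 X2 X Y : 'rV[R]_n,
      riemann c p Y X1 X2 (ricci_op c p X) + riemann c p Y X2 X1 (ricci_op c p X)
      - riemann c p X X1 X2 (ricci_op c p Y) - riemann c p X X2 X1 (ricci_op c p Y)
      = 0) ->
   forall (c : chart M) (p : M), dom c p ->
     forall (Z : 'I_1 -> 'rV[R]_n) (X Y : 'rV[R]_n),
       (n%:R / (n%:R - 1)) *:
         tensor_dot (metric c p) (riemann c p) (ricci11 c p) Z X Y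
       = (n%:R - 1)^-1 *: tachibana (ricci c p) (ricci11 c p) Z X Y
         - (n%:R * L p / (n%:R - 1)) *:
             tachibana (gT c p) (ricci11 c p) Z X Y)
  /\
  (* (iv) *)
  (forall (c : chart M) (p : M), dom c p -> forall X1 X2 X3 X4 : 'rV[R]_n,
     kulkarni_nomizu (ricci c p) (ricci c p) X1 X2 X3 X4
     = kulkarni_nomizu (gT c p) (ricci2 c p) X1 X2 X3 X4).
Proof.
split; [|split; [split|split]] => [c p hp|c p hp|c p hp|hcyc c p hp|c p hp].
- exact: (E_tensorE hn hp (hPP c p hp)).
- exact: (ricci2_quadratic hn hp (hPP c p hp)).
- exact: (scalar_curv2E hn hp (hPP c p hp)).
- move=> Z X Y; exact: (riemann_dot_ricci hn hp (hPP c p hp) Z X Y (hcyc c p hp)).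
- exact: (ricci_kulkarni_nomizu hn hp (hPP c p hp)).
Qed.
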